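(* (i) For every uniformly highly computable sequence $(G_e)_{e\in\mathbb{N}}$ of connected, locally finite multigraphs each of which has exactly one end, the set $\{e\in\mathbb{N} : G_e \text{ admits a two-way infinite Eulerian path}\}$ is $\Pi_1^0$. (ii) There is a uniformly highly computable sequence $(G_e)_{e\in\mathbb{N}}$ of connected, locally finite multigraphs each having exactly one end such that $\{e\in\mathbb{N} : G_e \text{ admits a two-way infinite Eulerian path}\}$ is $\Pi_1^0$-complete. That is, deciding whether a highly computable graph with one end admits a two-way Eulerian path is $\Pi_1^0$-complete.
   Context: Multigraphs are undirected, may have loops and multiple edges; the degree of a vertex is the number of incident edges, loops counted twice. A multigraph $G$ is highly computable if $V(G)$ is a decidable subset of $\mathbb{N}$, the function $(u,v)\mapsto$ (number of edges joining $u,v$) is computable, $G$ is locally finite, and the degree function is computable. A sequence $(G_e)$ is uniformly highly computable if these data are computable uniformly in $e$. For a connected locally finite multigraph $G$, the number of ends is the supremum, over finite sets $F$ of edges, of the number of infinite connected components of $G\smallsetminus F$. A two-way infinite Eulerian path is a sequence $(v_n)_{n\in\mathbb{Z}}$ of vertices with edges $e_n$ joining $v_n,v_{n+1}$ such that every edge of $G$ equals $e_n$ for exactly one $n\in\mathbb{Z}$. $\Pi_1^0$-complete means $\Pi_1^0$ and every $\Pi_1^0$ set is many-one reducible to it. *)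

(* Defs.v *)
From HB Require Import structures.
From Stdlib Require Export Relation_Operators.
From mathcomp Require Export all_boot all_order all_algebra.
From mathcomp Require Export finmap mathcomp_extra boolp classical_sets.
From mathcomp Require Export functions cardinality.

Set Implicit Arguments.
Unset Strict Implicit.
Unset Printing Implicit Defensive.

Local Open Scope classical_set_scope.
Local Open Scope card_scope.

Fixpoint primrec k (g : k.-tuple nat -> nat) (h : k.+2.-tuple nat -> nat)
    (n : nat) (x : k.-tuple nat) : nat :=
  if n is m.+1 then h [tuple of m :: primrec g h m x :: x] else g x.

(* The class of general recursive functions: it contains the initial functions
   and is closed under composition, primitive recursion, and minimization
   restricted to the cases where it yields a total function. By Kleene's normal
   form theorem these are exactly the total computable functions. *)
Inductive recursive : forall k : nat, (k.-tuple nat -> nat) -> Prop :=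
| rec_zero k : @recursive k (fun=> 0)
| rec_succ : @recursive 1 (fun x => (thead x).+1)
| rec_proj k (i : 'I_k) : @recursive k (fun x => tnth x i)
| rec_comp k m (g : m.-tuple nat -> nat) (h : 'I_m -> k.-tuple nat -> nat) :
    recursive g -> (forall i, recursive (h i)) ->
    @recursive k (fun x => g [tuple h i x | i < m])
| rec_prim k (g : k.-tuple nat -> nat) (h : k.+2.-tuple nat -> nat) :
    recursive g -> recursive h ->
    @recursive k.+1 (fun x => primrec g h (thead x) [tuple of behead x])
| rec_min k (f : k.+1.-tuple nat -> nat)
    (f_reg : forall x : k.-tuple nat, exists n, f [tuple of n :: x] == 0) :
    recursive f ->
    @recursive k (fun x => ex_minn (f_reg x)).

Definition computable1 (f : nat -> nat) : Prop :=
  @recursive 1 (fun x => f (nth 0 x 0)).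
Definition computable2 (f : nat -> nat -> nat) : Prop :=
  @recursive 2 (fun x => f (nth 0 x 0) (nth 0 x 1)).
Definition computable3 (f : nat -> nat -> nat -> nat) : Prop :=
  @recursive 3 (fun x => f (nth 0 x 0) (nth 0 x 1) (nth 0 x 2)).

Definition Pi01 (A : set nat) : Prop :=
  exists R : nat -> nat -> bool,
    computable2 R /\ (forall x, A x <-> forall n, R x n).

Definition many_one_reducible (A B : set nat) : Prop :=
  exists f : nat -> nat, computable1 f /\ (forall x, A x <-> B (f x)).

Definition Pi01_complete (A : set nat) : Prop :=
  Pi01 A /\ forall B : set nat, Pi01 B -> many_one_reducible B A.

(* The order of the pair [endpoints e] carries no information: everything below
   goes through the symmetric relation [joins]. *)
Record multigraph := Multigraph {
  vertices : set nat;
  edge : choiceType;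
  endpoints : edge -> nat * nat;
  endpointsP : forall e, vertices (endpoints e).1 /\ vertices (endpoints e).2
}.

Definition joins (G : multigraph) (e : edge G) (u v : nat) : Prop :=
  endpoints e = (u, v) \/ endpoints e = (v, u).

Definition edges_between (G : multigraph) (u v : nat) : set (edge G) :=
  [set e | joins e u v].
Arguments edges_between : clear implicits.

Definition incident_edges (G : multigraph) (v : nat) : set (edge G) :=
  [set e | exists u, joins e v u].
Arguments incident_edges : clear implicits.

Definition locally_finite (G : multigraph) : Prop :=
  forall v, vertices G v -> finite_set (incident_edges G v).

(* [fset_set] sends infinite sets to the empty set, so the next two numbers are
   meaningful only for locally finite [G]; they vanish outside [vertices G]. *)
Definition nb_edges (G : multigraph) (u v : nat) : nat :=
  #|` fset_set (edges_between G u v) |.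

(* loops counted twice *)
Definition degree (G : multigraph) (v : nat) : nat :=
  #|` fset_set (incident_edges G v) | + #|` fset_set (edges_between G v v) |.

Definition uniformly_highly_computable (G : nat -> multigraph) : Prop :=
  [/\ computable2 (fun e v => v \in vertices (G e)),
      computable3 (fun e u v => nb_edges (G e) u v),
      forall e, locally_finite (G e)
    & computable2 (fun e v => degree (G e) v)].

Definition adjacent (G : multigraph) (u v : nat) : Prop :=
  exists e : edge G, joins e u v.

Definition reachable (G : multigraph) : nat -> nat -> Prop :=
  clos_refl_trans nat (@adjacent G).

Definition connected_graph (G : multigraph) : Prop :=
  vertices G !=set0 /\
  forall u v, vertices G u -> vertices G v -> reachable G u v.

Definition component (G : multigraph) (v : nat) : set nat :=
  [set u | reachable G v u].

Definition infinite_components (G : multigraph) : set (set nat) :=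
  [set C | (exists2 v, vertices G v & C = component G v) /\ infinite_set C].

Definition delete_edges (G : multigraph) (F : set (edge G)) : multigraph :=
  @Multigraph (vertices G) {e : edge G | e \notin F}
    (fun e => endpoints (val e)) (fun e => endpointsP (val e)).

Definition ends_at_most (G : multigraph) (k : nat) : Prop :=
  forall F : set (edge G), finite_set F ->
    infinite_components (delete_edges F) #<= `I_k.

(* The supremum defining the number of ends, taken in the extended natural
   numbers, equals k: k is the least upper bound. *)
Definition has_number_of_ends (G : multigraph) (k : nat) : Prop :=
  ends_at_most G k /\ forall k', ends_at_most G k' -> k <= k'.

Definition two_way_eulerian (G : multigraph) : Prop :=
  exists (v : int -> nat) (p : int -> edge G),
    (forall n : int, joins (p n) (v n) (v (n + 1)%R)) /\
    (forall e : edge G, exists! n : int, p n = e).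

(* Main.v *)
Require Import Defs.

(** A connected locally finite graph with one end has a two-way infinite Eulerian path
    if and only if all its degrees are even, and the latter is a [Pi01] condition.
    For the nontrivial direction, finite cuts of an even graph are even, so a finite
    trail can always be closed up outside the edges used so far: its two ends cannot
    be separated by a finite component, and there is only one infinite component.
    Hence closed trails can be enlarged at any vertex they visit, to contain any
    prescribed edges and all finite components of the complement. Splitting such an
    enlargement at a vertex that still has unused edges extends the current trail at
    both of its ends, and the limit is the desired path.

    For hardness, a universal stack machine yields a computable relation
    [runs_on z n] such that every [Pi01] set reduces to [forall n, runs_on z n]. In the
    ray with vertices [0, 1, 2, ...] and one or two edges from [n] to [n + 1], two
    exactly if [runs_on z n] holds, all degrees are even if and only if all edges are
    double. *)

Set Implicit Arguments.
Unset Strict Implicit.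
Unset Printing Implicit Defensive.

Local Open Scope classical_set_scope.

(** * Walks, cuts and connectivity *)

Section Walks.
Variable G : multigraph.
Implicit Types (e f : edge G) (s t X Y C : seq (edge G)) (u v w : nat).

Definition inc e u := (u == (endpoints e).1) || (u == (endpoints e).2).

Definition other e u :=
  if u == (endpoints e).1 then (endpoints e).2 else (endpoints e).1.

Lemma joinsP e u v : joins e u v <-> inc e u /\ other e u = v.
Proof.
rewrite /joins /inc /other; case: (endpoints e) => x y /=; split.
  case=> -[-> ->]; first by rewrite eqxx.
  by rewrite eqxx orbT; case: eqP => // ->.
case=> /orP[/eqP->|/eqP->]; first by rewrite eqxx => ->; left.
by case: eqP => [->|_] ->; [left|right].
Qed.

Lemma inc_joins e u v : joins e u v -> inc e v.
Proof. by rewrite /inc; case=> ->; rewrite /= eqxx ?orbT. Qed.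

Lemma inc_other e u : inc e u -> inc e (other e u).
Proof. by rewrite /inc /other; case: ifP => _ _; rewrite eqxx ?orbT. Qed.

Lemma otherK e u : inc e u -> other e (other e u) = u.
Proof.
rewrite /inc /other; case: (eqVneq u (endpoints e).1) => [->|_ /= /eqP ->].
  by case: (eqVneq (endpoints e).2 (endpoints e).1) => [->|].
by rewrite eqxx.
Qed.

Lemma inc_eq e u w : inc e u -> inc e w -> w = u \/ w = other e u.
Proof.
rewrite /inc /other; case: (endpoints e) => x y /=.
case: (eqVneq u x) => [->|_ /= /eqP ->] /=.
  by move=> _ /orP[/eqP|/eqP]; [left|right].
by case/orP=> /eqP; [right|left].
Qed.

Lemma vertices_inc e u : inc e u -> vertices G u.
Proof. by have [h1 h2] := endpointsP e; case/orP=> /eqP->. Qed.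

(** Only the edges are stored; the vertices are recovered from the start by [other], so reversing or
    splicing walks is reversing or splicing lists. *)
Fixpoint walk u s v : bool :=
  if s is e :: s' then inc e u && walk (other e u) s' v else u == v.

Lemma walk_cat u s w t v : walk u s w -> walk w t v -> walk u (s ++ t) v.
Proof. by elim: s u => [u /eqP->//|e s IH u /= /andP[-> /IH]]. Qed.

Lemma walk_catP u s t v : walk u (s ++ t) v -> exists2 w, walk u s w & walk w t v.
Proof.
elim: s u => [u|e s IH u /= /andP[ieu /IH[w]]]; first by exists u => /=.
by exists w => //; rewrite ieu.
Qed.

Lemma walk1 e u : inc e u -> walk u [:: e] (other e u).
Proof. by move=> /= ->; rewrite eqxx. Qed.

Lemma walk_rev u s v : walk u s v -> walk v (rev s) u.
Proof.
elim: s u => [u /= /eqP->//|e s IH u /= /andP[ieu /IH h]].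
rewrite rev_cons -cats1; apply: (walk_cat h).
by rewrite -[X in walk _ _ X](otherK ieu); apply/walk1/inc_other.
Qed.

Lemma walk_split u s v e w :
  walk u s v -> e \in s -> inc e w ->
  exists s1 s2, [/\ s = s1 ++ s2, walk u s1 w & walk w s2 v].
Proof.
move=> us_v es iew; move: us_v; case/splitPr: es => s1 s2 /walk_catP[x us1].
move=> /= /andP[iex xs2]; have [->|wx] := inc_eq iex iew.
  by exists s1, (e :: s2); split=> //=; rewrite iex.
exists (rcons s1 e), s2; rewrite cat_rcons wx; split=> //.
by rewrite -cats1; apply: (walk_cat us1 (walk1 iex)).
Qed.

(** If the first edge recurs later in the same direction, the detour up to that recurrence is
    dropped; if it recurs in the opposite direction, both traversals and all that lies between them
    are dropped. *)
Lemma uniq_walk u s v : walk u s v ->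
  exists t, [/\ walk u t v, uniq t & {subset t <= s}].
Proof.
have [n] := ubnP (size s); elim: n => // n IH in u s *.
case: s => [|e s] /=; first by exists [::].
move=> sz /andP[ieu].
case: (boolP (e \in s)) => [es|eNs h].
  case/splitPr: es sz => s1 s2; rewrite size_cat /= => sz /walk_catP[x _] /=.
  case/andP=> iex; have [->|->] := inc_eq ieu iex => h.
    have [||t [ht ut st]] := IH u (e :: s2).
    - exact: leq_ltn_trans (leq_addl _ _) sz.
    - by rewrite /= ieu.
    exists t; split=> // z /st; rewrite !inE mem_cat inE.
    by case/orP=> ->; rewrite ?orbT.
  move: h; rewrite otherK // => h.
  have [|t [ht ut st]] := IH u s2 _ h.
    exact: leq_trans (leq_addl _ _) (ltnW sz).
  by exists t; split=> // z /st zs; rewrite !inE mem_cat inE zs !orbT.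
have [t [ht ut st]] := IH _ s sz h.
exists (e :: t); split => /=.
- by rewrite ieu.
- by rewrite ut andbT; apply: contra eNs => /st.
- by move=> z; rewrite !inE => /orP[->//|/st->]; rewrite orbT.
Qed.

Definition avoids X s := all (fun e => e \notin X) s.

Lemma avoidsP X s : reflect {in s, forall e, e \notin X} (avoids X s).
Proof. exact: allP. Qed.

Definition reach X u v := exists2 s, walk u s v & avoids X s.

Lemma reach_refl X u : reach X u u.
Proof. by exists [::] => /=. Qed.

Lemma reach_trans X u v w : reach X u v -> reach X v w -> reach X u w.
Proof.
move=> [s us sX] [t vt tX]; exists (s ++ t); first exact: walk_cat us vt.
by rewrite /avoids all_cat; apply/andP.
Qed.

Lemma reach_sym X u v : reach X u v -> reach X v u.
Proof.
by case=> s us sX; exists (rev s); [exact: walk_rev|rewrite /avoids all_rev].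
Qed.

Lemma reach_other X e u : e \notin X -> inc e u -> reach X u (other e u).
Proof. by move=> eX ieu; exists [:: e]; [exact: walk1|rewrite /= eX]. Qed.

Lemma reach_inc X e u w : e \notin X -> inc e u -> inc e w -> reach X u w.
Proof.
move=> eX ieu iew; have [->|->] := inc_eq ieu iew; first exact: reach_refl.
exact: reach_other.
Qed.

Lemma reach_sub X Y u v : {subset X <= Y} -> reach Y u v -> reach X u v.
Proof.
by move=> XY [s us sY]; exists s => //; apply: sub_all sY => e; apply/contra/XY.
Qed.

Lemma reach_walk X u s v e w : walk u s v -> avoids X s -> e \in s -> inc e w ->
  reach X u w.
Proof.
move=> us sX es iew; have [s1 [s2 [ss us1 _]]] := walk_split us es iew.
by exists s1 => //; move: sX; rewrite ss /avoids all_cat => /andP[].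
Qed.

Lemma uniq_reach X u v : reach X u v ->
  exists2 s, walk u s v & uniq s && avoids X s.
Proof.
case=> s us /avoidsP sX; have [t [ht ut st]] := uniq_walk us.
by exists t => //; rewrite ut; apply/avoidsP => e /st /sX.
Qed.

Lemma uniq_cat_avoids X s : uniq (X ++ s) = [&& uniq X, avoids X s & uniq s].
Proof. by rewrite cat_uniq -all_predC. Qed.

Definition cross (K : pred nat) e := K (endpoints e).1 (+) K (endpoints e).2.

Lemma cross_other K e u : inc e u -> cross K e = K u (+) K (other e u).
Proof.
rewrite /inc /cross /other; case: (eqVneq u (endpoints e).1) => [->//|_ /= /eqP->].
exact: addbC.
Qed.

Lemma odd_count_cross K u s v :
  walk u s v -> odd (count (cross K) s) = K u (+) K v.
Proof.
elim: s u => [u /eqP->/=|e s IH u /= /andP[ieu /IH h]]; first by rewrite addbb.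
by rewrite oddD h oddb (cross_other K ieu) addbA addbK.
Qed.

(** This is the cut form of the condition that all degrees in [X] are even. Closed walks satisfy it
    because a walk crosses a cut oddly only when its two ends are separated. *)
Definition balanced X := forall K : pred nat, ~~ odd (count (cross K) X).

Lemma balanced_cat X s u : balanced X -> walk u s u -> balanced (X ++ s).
Proof.
by move=> bX us K; rewrite count_cat oddD (odd_count_cross K us) addbb addbF bX.
Qed.

End Walks.

Lemma odd_sum_count (T : Type) (a b : pred T) (s : seq T) :
  odd (\sum_(x <- s) (a x + b x)) = odd (count (fun x => a x (+) b x) s).
Proof.
elim: s => [|x s IH]; first by rewrite big_nil.
by rewrite big_cons /= !oddD IH !oddb.
Qed.

Lemma eq_count_uniq (T : eqType) (p : pred T) (s t : seq T) :
  uniq s -> uniq t -> {in p, forall x, (x \in s) = (x \in t)} ->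
  count p s = count p t.
Proof.
move=> us ut st; rewrite -!size_filter; apply/perm_size/uniq_perm.
- exact: filter_uniq.
- exact: filter_uniq.
by move=> x; rewrite !mem_filter; case px: (p x) => //=; apply: st.
Qed.

(** * Two-way Eulerian paths in even one-ended graphs *)

Section Euler.
Variables (G : multigraph) (star : nat -> seq (edge G)).
Implicit Types (e f : edge G) (s t X Y C F : seq (edge G)) (u v w : nat).

Hypothesis star_uniq : forall v, uniq (star v).
Hypothesis mem_star : forall v e, (e \in star v) = inc e v.
Hypothesis star_even : forall v,
  ~~ odd (\sum_(e <- star v) ((v == (endpoints e).1) + (v == (endpoints e).2))).
Hypothesis one_end : forall X u v, infinite_set (reach X u) ->
  infinite_set (reach X v) -> reach X u v.

(** Handshake argument: the degrees of the vertices of [K] add up to an even number, in which each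
    edge inside [K] counts twice and each edge of the cut once. *)
Lemma even_cut (K : seq nat) X : uniq K -> uniq X ->
  (forall e, cross (mem K) e -> e \in X) -> ~~ odd (count (cross (mem K)) X).
Proof.
(* The finite list [I] contains every edge meeting [K], so the sums over vertices and edges can be
   exchanged. *)
move=> uK uX crossX; set I := undup (X ++ flatten (map star K)).
have IK v e : v \in K -> inc e v -> e \in I.
  move=> vK iev; rewrite mem_undup mem_cat; apply/orP; right.
  by apply/flattenP; exists (star v); [exact: map_f|rewrite mem_star].
have -> : count (cross (mem K)) X = count (cross (mem K)) I.
  apply: eq_count_uniq; rewrite ?undup_uniq // => e ce.
  by rewrite mem_undup mem_cat crossX.
rewrite -odd_sum_count.
have sumK x : (x \in K) = \sum_(v <- K) (v == x) :> nat.
  rewrite -count_uniq_mem // -sum1_count big_mkcond; apply: eq_bigr => v _ /=.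
  by case: eqP.
under eq_bigr do rewrite !inE !sumK -big_split.
rewrite exchange_big /=.
elim: (K) {sumK} IK => [|v K' IH] IK; first by rewrite big_nil.
have {}IH := negbTE (IH (fun w e wK => IK w e (@mem_behead _ (v :: K') w wK))).
rewrite big_cons oddD IH addbF.
rewrite (_ : \sum_(i <- I) _ = \sum_(e <- star v)
  ((v == (endpoints e).1) + (v == (endpoints e).2))).
  exact: star_even.
rewrite [LHS](bigID (fun e => inc e v)) /= [X in _ + X]big1 ?addn0; last first.
  by move=> e; rewrite /inc negb_or => /andP[/negbTE-> /negbTE->].
rewrite -big_filter; apply/perm_big/uniq_perm => //.
  exact/filter_uniq/undup_uniq.
move=> e; rewrite mem_filter mem_star; case iev: (inc e v) => //=.
by apply: IK iev; rewrite mem_head.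
Qed.

(* Otherwise the component of [u] or of [v] outside [X ++ s] is finite, and its cut,
   which lies in [X ++ s], is crossed an odd number of times. *)
Lemma reach_close X s u v : uniq (X ++ s) -> balanced X -> walk u s v ->
  reach (X ++ s) v u.
Proof.
move=> uXs bX us; apply: contrapT => nr.
have inf x y : (forall K : pred nat, K x (+) K y = K u (+) K v) ->
    ~ reach (X ++ s) x y -> infinite_set (reach (X ++ s) x).
  move=> xy nxy /finite_seqP[K0 eqK].
  have memK z : (z \in undup K0) <-> reach (X ++ s) x z.
    by rewrite mem_undup; have -> : reach (X ++ s) x z = [set` K0] z by rewrite eqK.
  suff /(even_cut (undup_uniq K0) uXs)/negP :
      forall e, cross (mem (undup K0)) e -> e \in X ++ s.
    apply; rewrite count_cat oddD (negbTE (bX _)) (odd_count_cross _ us) -xy /=.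
    have -> : x \in undup K0 by apply/memK/reach_refl.
    by rewrite addTb; apply/negP => /memK.
  move=> e; apply: contraLR => eXs; rewrite /cross /=.
  have r12 : reach (X ++ s) (endpoints e).1 (endpoints e).2.
    by apply: (reach_inc eXs); rewrite /inc eqxx ?orbT.
  have -> : ((endpoints e).1 \in undup K0) = ((endpoints e).2 \in undup K0).
    apply/idP/idP => /memK r; apply/memK.
      exact: reach_trans r r12.
    exact: reach_trans r (reach_sym r12).
  by rewrite addbb.
apply: (nr); apply: one_end.
  by apply: (inf v u) nr => K; exact: addbC.
by apply: (inf u v) => // nr'; apply: nr; apply: reach_sym.
Qed.

(** The one-edge trail [f] is closed up by [reach_close], and the return walk can be chosen without
    repetitions. *)
Lemma closed_walk_through Y w f : uniq Y -> balanced Y -> f \notin Y -> inc f w ->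
  exists2 t, walk w (f :: t) w & uniq (Y ++ f :: t).
Proof.
move=> uY bY fY ifw.
have uYf : uniq (Y ++ [:: f]) by rewrite cats1 rcons_uniq fY.
have /uniq_reach[t wt /andP[ut tYf]] := reach_close uYf bY (walk1 ifw).
exists t; first by rewrite /= ifw.
by rewrite -cat1s catA uniq_cat_avoids uYf tYf.
Qed.

(** * Enlarging closed trails *)

Definition visits C c w :=
  exists C1 C2, [/\ C = C1 ++ C2, walk c C1 w & walk w C2 c].

Lemma visits_inc C c e w : walk c C c -> e \in C -> inc e w -> visits C c w.
Proof. by move=> cC eC iew; have := walk_split cC eC iew. Qed.

Lemma visits_base C c : walk c C c -> visits C c c.
Proof. by exists [::], C; split=> /=. Qed.

(** [X] holds the edges already used by the trails built so far, [C] the closed trail under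
    construction. *)
Definition closed_off X C c := uniq (X ++ C) && walk c C c.

(** A closed trail through [f] is spliced into [C] at [w]. The inserted edges [f :: t] are made
    explicit because [absorb] has to locate them in one component. *)
Lemma closed_grow X C c w f : balanced X -> closed_off X C c -> visits C c w ->
  f \notin X ++ C -> inc f w ->
  exists D t, [/\ closed_off X D c, D =i C ++ f :: t, walk w (f :: t) w
    & avoids (X ++ C) (f :: t)].
Proof.
move=> bX /andP[uXC cC] [C1 [C2 [CC cC1 wC2]]] fXC ifw.
have [t wt ut] := closed_walk_through uXC (balanced_cat bX cC) fXC ifw.
have pD : perm_eq (C1 ++ (f :: t) ++ C2) (C ++ f :: t).
  by rewrite CC -catA perm_cat2l perm_catC.
exists (C1 ++ (f :: t) ++ C2), t; split=> //.
- apply/andP; split; last exact: walk_cat cC1 (walk_cat wt wC2).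
  by rewrite (perm_uniq (_ : perm_eq _ ((X ++ C) ++ f :: t))) // -catA perm_cat2l.
- exact: perm_mem pD.
- by move: ut; rewrite uniq_cat_avoids => /and3P[].
Qed.

(** The edges of [s] are added in order. A missing edge starts at [c] or at an end of the preceding
    edge, which is already covered, so the closed trail can be grown there. *)
Lemma cover_walk X C c s v : balanced X -> closed_off X C c ->
  walk c s v -> avoids X s ->
  exists D, [/\ closed_off X D c, {subset C <= D} & {subset s <= D}].
Proof.
move=> bX; elim/last_ind: s v => [|s f IH] v clC; first by exists C; split.
rewrite -cats1 /avoids all_cat => /walk_catP[w cs] /= /andP[ifw _].
rewrite andbT => /andP[sX fX].
have [D [clD CD sD]] := IH _ clC cs sX.
have [fD|fD] := boolP (f \in D).
  exists D; split=> // e; rewrite mem_cat mem_seq1 => /orP[/sD//|/eqP->//].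
have vw : visits D c w.
  have /andP[_ cD] := clD.
  case/lastP: s cs sD {IH sX} => [/eqP<- _|s e]; first exact: visits_base.
  rewrite -cats1 => /walk_catP[x _ /= /andP[iex /eqP <-]] sD.
  apply: (visits_inc cD _ (inc_other iex)); apply: sD.
  by rewrite mem_cat mem_head orbT.
have fXD : f \notin X ++ D by rewrite mem_cat negb_or fX.
have [D' [t [clD' eqD' _ _]]] := closed_grow bX clD vw fXD ifw.
exists D'; split=> // e.
  by move=> /CD eD; rewrite eqD' mem_cat eD.
rewrite mem_cat mem_seq1 eqD' mem_cat inE => /orP[/sD->//|->].
by rewrite orbT.
Qed.

Lemma cover_edges X C c F : balanced X ->
  (forall e, e \notin X -> reach X c (endpoints e).1) -> closed_off X C c ->
  exists D, [/\ closed_off X D c, {subset C <= D} & {subset F <= X ++ D}].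
Proof.
move=> bX conn clC; elim: F => [|f F [D [clD CD FD]]]; first by exists C; split.
have [fX|fX] := boolP (f \in X).
  exists D; split=> // e; rewrite inE => /orP[/eqP->|/FD//].
  by rewrite mem_cat fX.
have [s cs sX] := conn f fX.
have if1 : inc f (endpoints f).1 by rewrite /inc eqxx.
have [|D' [clD' DD' sD']] := cover_walk bX clD (walk_cat cs (walk1 if1)).
  by rewrite /avoids all_cat; apply/andP; split=> //=; rewrite fX.
exists D'; split=> // e; first by move/CD/DD'.
rewrite inE mem_cat => /orP[/eqP->|/FD].
  by rewrite sD' ?orbT // mem_cat mem_head orbT.
by rewrite mem_cat => /orP[->//|/DD'->]; rewrite orbT.
Qed.

(** Take the part of the walk after its last edge in [C]: it starts on [C] and avoids [C] from then
    on. *)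
Lemma reach_frontier X C c v : walk c C c -> reach X c v ->
  exists2 w, visits C c w & reach (X ++ C) w v.
Proof.
move=> cC [s]; elim/last_ind: s v => [|s e IH] v.
  by move=> /eqP<- _; exists c; [exact: visits_base|exact: reach_refl].
rewrite -cats1 /avoids all_cat => /walk_catP[x cs] /= /andP[iex /eqP<-].
rewrite andbT => /andP[sX eX].
have [eC|eC] := boolP (e \in C).
  exists (other e x); last exact: reach_refl.
  exact: visits_inc cC eC (inc_other iex).
have [w vw wx] := IH _ cs sX; exists w => //; apply: (reach_trans wx).
by apply: reach_other => //; rewrite mem_cat negb_or eX.
Qed.

Lemma reach_first_edge Y w e : e \notin Y -> reach Y w (endpoints e).1 ->
  exists2 f, f \notin Y & inc f w.
Proof.
move=> eY [[|f s] /=]; first by move=> /eqP-> _; exists e; rewrite // /inc eqxx.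
by move=> /andP[ifw _] /andP[fY _]; exists f.
Qed.

Definition bad Y e := e \notin Y /\ finite_set (reach Y (endpoints e).1).

Lemma reach_eq Y u v : reach Y u v -> reach Y u = reach Y v.
Proof.
move=> uv; apply/funext => w; apply/propext; split; last exact: reach_trans.
exact: reach_trans (reach_sym uv).
Qed.

Lemma bad_listable X C c : walk c C c ->
  (forall e, e \notin X -> reach X c (endpoints e).1) ->
  exists B : seq (edge G), forall e, bad (X ++ C) e -> e \in B.
Proof.
move=> cC conn.
have [B hB] : exists B : seq (edge G), forall e, bad (X ++ C) e ->
    (exists2 w, w \in c :: flatten [seq [:: (endpoints e).1; (endpoints e).2] | e <- C]
     & reach (X ++ C) w (endpoints e).1) -> e \in B.
  (* Candidate vertices are treated one by one: one with a finite component contributes the stars of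
     that component, one with an infinite component contributes no bad edge. *)
  elim: (c :: _) => [|w W [B hB]]; first by exists [::] => e _ [].
  have [/finite_seqP[K eqK]|inf] := pselect (finite_set (reach (X ++ C) w)).
    exists (flatten (map star K) ++ B) => e be [x]; rewrite mem_cat inE.
    move=> /orP[/eqP-> r|xW r]; last by rewrite (hB e be) ?orbT //; exists x.
    apply/orP; left; apply/flattenP; exists (star (endpoints e).1).
      by apply: map_f; move: r; rewrite eqK.
    by rewrite mem_star /inc eqxx.
  exists B => e be [x]; rewrite inE => /orP[/eqP-> r|xW r]; last first.
    by apply: (hB e be); exists x.
  by case: inf; rewrite (reach_eq r); case: be.
exists B => e be; apply: (hB e be).
have [eXC _] := be; have /conn : e \notin X.
  by apply: contra eXC; rewrite mem_cat => ->.
case/(reach_frontier cC) => w [C1 [C2 [CC cC1 _]]] wr; exists w => //.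
case/lastP: C1 CC cC1 => [_ /eqP->|C1 f CC]; first exact: mem_head.
rewrite -cats1 => /walk_catP[x _ /= /andP[ifx /eqP <-]].
rewrite inE; apply/orP; right; apply/flattenP.
exists [:: (endpoints f).1; (endpoints f).2].
  apply/mapP; exists f => //.
  by rewrite CC mem_cat mem_rcons mem_head.
by have := inc_other ifx; rewrite /inc !inE.
Qed.

(* Edges in finite components of the complement can never be reached once the
   trail has moved on, so they are inserted now; the trails that insert them stay
   inside their component, hence create no new finite components elsewhere. *)
Lemma absorb X C c : balanced X ->
  (forall e, e \notin X -> reach X c (endpoints e).1) -> closed_off X C c ->
  exists D, [/\ closed_off X D c, {subset C <= D} & forall e, ~ bad (X ++ D) e].
Proof.
move=> bX conn clC; have /andP[_ cC] := clC.
have [B hB] := bad_listable cC conn; have [n] := ubnP (size B).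
elim: n => // n IH in C clC cC B hB * => szB.
have [[e be]|nbad] := pselect (exists e, bad (X ++ C) e); last first.
  by exists C; split=> // e be; apply: nbad; exists e.
have [eXC fine] := be; have /conn : e \notin X.
  by apply: contra eXC; rewrite mem_cat => ->.
case/(reach_frontier cC) => w vw we.
have [f fXC ifw] := reach_first_edge eXC we.
have [D [t [clD eqD wt tXC]]] := closed_grow bX clC vw fXC ifw.
have finw : finite_set (reach (X ++ C) w) by rewrite (reach_eq we).
have /andP[_ cD] := clD.
have CD : {subset C <= D} by move=> z zC; rewrite eqD mem_cat zC.
have XCD : {subset X ++ C <= X ++ D}.
  by move=> z; rewrite !mem_cat => /orP[->//|/CD->]; rewrite orbT.
have bf : bad (X ++ C) f.
  split=> //; rewrite -(@reach_eq _ w) //.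
  by apply: (reach_inc fXC ifw); rewrite /inc eqxx.
have [||D' [clD' DD' nbad]] := IH D clD cD (filter (predC1 f) B).
- move=> g [gXD fing].
  have gXC : g \notin X ++ C by apply: contra gXD => /XCD.
  rewrite mem_filter /= hB ?andbT.
    by apply: contra gXD => /eqP->; rewrite mem_cat eqD mem_cat mem_head !orbT.
  split=> //; apply: contrapT => infg; apply: (infg); apply: sub_finite_set fing.
  move=> x [s gs sXC]; exists s => //; apply/avoidsP => h hs.
  have hXC : h \notin X ++ C by move/avoidsP: sXC; apply.
  rewrite mem_cat eqD mem_cat orbA -mem_cat negb_or hXC.
  apply/negP => ht; apply: infg.
  have ih : inc h (endpoints h).1 by rewrite /inc eqxx.
  rewrite (reach_eq (reach_walk gs sXC hs ih)).
  by rewrite -(reach_eq (reach_walk wt tXC ht ih)).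
- rewrite size_filter -ltnS; apply: leq_trans szB.
  rewrite ltnS -[ltnRHS](count_predC (pred1 f)).
  by rewrite -[X in X < _]add0n ltn_add2r -has_count has_pred1 hB.
by exists D'; split=> // z /CD /DD'.
Qed.

(** * Extending the two trails at both ends *)

Variable a : nat.
Hypothesis connected_base : forall e, @reach G [::] a (endpoints e).1.
Hypothesis infinite_edges : forall X, exists e, e \notin X.

(* The reverse of [L] followed by [R] is a closed trail at [c] through [a]; its two
   ends grow into the two halves of the Eulerian path. *)
Definition twin_trails (L R : seq (edge G)) c :=
  [/\ walk a L c, walk a R c, uniq (L ++ R) & forall e, e \notin L ++ R -> reach (L ++ R) c (endpoints e).1].

Lemma twin_trails_extend n L R c : twin_trails L R c -> exists P Q d,
  [/\ P != [::], Q != [::], twin_trails (L ++ P) (R ++ Q) d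
    & {subset star n <= (L ++ P) ++ (R ++ Q)}].
Proof.
case=> aL aR uLR conn; set X := L ++ R.
have bX : balanced X.
  move=> K; rewrite count_cat oddD (odd_count_cross K aL) (odd_count_cross K aR).
  by rewrite addbb.
have cl0 : closed_off X [::] c by rewrite /closed_off cats0 uLR /=.
have [D0 [clD0 _ coverD0]] := cover_edges (star c ++ star n) bX conn cl0.
have [D [clD D0D nbad]] := absorb bX conn clD0.
have coverD e : e \in star c ++ star n -> e \in X ++ D.
  by move/coverD0; rewrite !mem_cat => /orP[->//|/D0D->]; rewrite orbT.
have /andP[uXD cD] := clD.
have [e0 e0XD] := infinite_edges (X ++ D).
have /conn : e0 \notin X by apply: contra e0XD; rewrite (mem_cat _ X) => ->.
case/(reach_frontier cD) => d vd de0.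
have [g gXD igd] := reach_first_edge e0XD de0.
have dc : d != c.
  apply: contra gXD => /eqP dc; apply: coverD.
  by rewrite mem_cat mem_star -dc igd.
(* [Q] leads from [c] to [d] and prolongs [R]; [P] leads back to [c], so its reverse prolongs
   [L]. *)
have [Q [P [DQP cQ dP]]] := vd.
have pXD : perm_eq ((L ++ rev P) ++ (R ++ Q)) (X ++ D).
  rewrite /X DQP -!catA perm_cat2l perm_catCA perm_cat2l perm_catC perm_cat2l.
  by rewrite perm_rev.
exists (rev P), Q, d; split.
- apply: contra dc; rewrite -size_eq0 size_rev size_eq0 => /eqP P0.
  by move: dP; rewrite P0.
- by apply: contra dc => /eqP Q0; move: cQ; rewrite Q0 /= eq_sym.
- split; [exact: walk_cat aL (walk_rev dP)|exact: walk_cat aR cQ| |].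
    by rewrite (perm_uniq pXD).
  move=> e; rewrite (perm_mem pXD) => eXD.
  apply: (@reach_sub _ _ (X ++ D)) => [x|]; first by rewrite (perm_mem pXD).
  have ig : inc g (endpoints g).1 by rewrite /inc eqxx.
  apply: (reach_trans (reach_inc gXD igd ig)).
  by apply: one_end => fin; [apply: (nbad g)|apply: (nbad e)].
- by move=> e en; rewrite (perm_mem pXD) coverD // mem_cat en orbT.
Qed.

Lemma twin_trails_sequence : exists (L R : nat -> seq (edge G)) (c : nat -> nat),
  [/\ forall n, exists2 P, P != [::] & L n.+1 = L n ++ P,
      forall n, exists2 Q, Q != [::] & R n.+1 = R n ++ Q,
      forall n, twin_trails (L n) (R n) (c n)
    & forall n, {subset star n <= L n.+1 ++ R n.+1}].
Proof.
pose S := {x : seq (edge G) * seq (edge G) * nat | twin_trails x.1.1 x.1.2 x.2}.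
have step (x : nat * S) : exists y : S,
    [/\ exists2 P, P != [::] & (sval y).1.1 = (sval x.2).1.1 ++ P,
        exists2 Q, Q != [::] & (sval y).1.2 = (sval x.2).1.2 ++ Q
      & {subset star x.1 <= (sval y).1.1 ++ (sval y).1.2}].
  case: x => n [[[L R] c] /= tt].
  have [P [Q [d [P0 Q0 tt' sn]]]] := twin_trails_extend n tt.
  exists (exist _ (L ++ P, R ++ Q, d) tt').
  by split=> //=; [exists P|exists Q].
have [next nextP] := boolp.choice step.
have tt0 : twin_trails [::] [::] a.
  by split=> //= e _; exact: connected_base.
pose x0 : S := exist _ ([::], [::], a) tt0.
pose x := fix x n := if n is m.+1 then next (m, x m) else x0.
exists (fun n => (sval (x n)).1.1), (fun n => (sval (x n)).1.2),
  (fun n => (sval (x n)).2); split=> n.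
- by have [] := nextP (n, x n).
- by have [] := nextP (n, x n).
- exact: (svalP (x n)).
- by have [] := nextP (n, x n).
Qed.

End Euler.

(** * The infinite trail defined by a growing chain of finite ones *)

Section Rays.
Variables (G : multigraph) (a : nat) (e0 : edge G).
Variables (L : nat -> seq (edge G)) (c : nat -> nat).
Hypothesis grow : forall n, exists2 P, P != [::] & L n.+1 = L n ++ P.
Hypothesis walkL : forall n, walk a (L n) (c n).

Lemma chain_prefix m n : m <= n -> exists s, L n = L m ++ s.
Proof.
elim: n => [|n IH]; first by rewrite leqn0 => /eqP->; exists [::]; rewrite cats0.
rewrite leq_eqVlt => /orP[/eqP->|]; first by exists [::]; rewrite cats0.
rewrite ltnS => /IH[s Ln]; have [P _ ->] := grow n.
by exists (s ++ P); rewrite Ln catA.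
Qed.

Lemma chain_size n : n <= size (L n).
Proof.
elim: n => // n IH; have [P P0 ->] := grow n; rewrite size_cat -addn1 leq_add //.
by case: P P0.
Qed.

(** Since [L i.+1] has at least [i.+1] edges, the default [e0] is never reached. *)
Definition ray_edge i := nth e0 (L i.+1) i.

Fixpoint ray_vertex i := if i is j.+1 then other (ray_edge j) (ray_vertex j) else a.

Lemma nth_chain n i : i < size (L n) -> nth e0 (L n) i = ray_edge i.
Proof.
move=> iLn; rewrite /ray_edge; have [nm|/ltnW nm] := leqP n i.+1.
  by have [s ->] := chain_prefix nm; rewrite nth_cat iLn.
by have [s ->] := chain_prefix nm; rewrite nth_cat chain_size.
Qed.

Lemma mem_chain n e : e \in L n -> exists i, ray_edge i = e.
Proof.
move=> eL; exists (index e (L n)); rewrite -(@nth_chain n) ?index_mem //.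
exact: nth_index.
Qed.

Lemma joins_ray i : joins (ray_edge i) (ray_vertex i) (ray_vertex i.+1).
Proof.
apply/joinsP; split=> //.
(* The walk [L i.+1] from its [j]-th vertex on starts at [ray_vertex j]; the case [j = i] shows that
   [ray_edge i] is incident to [ray_vertex i]. *)
suff walk_drop j : j <= i.+1 -> walk (ray_vertex j) (drop j (L i.+1)) (c i.+1).
  have := walk_drop i (leqnSn i).
  by rewrite (drop_nth e0) ?chain_size //= => /andP[].
elim: j => [_|j IH ji]; first by rewrite drop0.
have jL : j < size (L i.+1) := leq_trans ji (chain_size _).
by have := IH (ltnW ji); rewrite (drop_nth e0) //= nth_chain // => /andP[].
Qed.

End Rays.

Section EvenEulerian.
Variables (G : multigraph) (star : nat -> seq (edge G)) (a : nat).
Hypothesis star_uniq : forall v, uniq (star v).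
Hypothesis mem_star : forall v e, (e \in star v) = inc e v.
Hypothesis star_even : forall v,
  ~~ odd (\sum_(e <- star v) ((v == (endpoints e).1) + (v == (endpoints e).2))).
Hypothesis one_end : forall (X : seq (edge G)) u v, infinite_set (reach X u) ->
  infinite_set (reach X v) -> reach X u v.
Hypothesis connected_base : forall e : edge G, @reach G [::] a (endpoints e).1.
Hypothesis infinite_edges : forall X : seq (edge G), exists e, e \notin X.

Lemma even_two_way_eulerian : two_way_eulerian G.
Proof.
have [L [R [c [growL growR tt cover]]]] := twin_trails_sequence star_uniq
  mem_star star_even one_end connected_base infinite_edges.
have [e0 _] := infinite_edges [::].
have walkL n : walk a (L n) (c n) by case: (tt n).
have walkR n : walk a (R n) (c n) by case: (tt n).
have uLR n : uniq (L n ++ R n) by case: (tt n).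
(* Nonnegative indices follow [R] away from [a], negative ones follow [L] in reverse. As [Negz i] is
   [-(i + 1)], it carries edge [i] of [L] and vertex [i.+1]. *)
pose p k := match k with Posz i => ray_edge e0 R i | Negz i => ray_edge e0 L i end.
exists (fun k => match k with
  | Posz i => ray_vertex a e0 R i | Negz i => ray_vertex a e0 L i.+1 end), p.
split.
  case=> [i|[|i]].
  - by rewrite -PoszD addn1; exact: joins_ray growR walkR i.
  - by case: (joins_ray e0 growL walkL 0) => ?; [right|left].
  - have -> : (Negz i.+1 + 1)%R = Negz i.
      by rewrite !NegzE -addn1 PoszD GRing.opprD GRing.addrNK.
    by case: (joins_ray e0 growL walkL i.+1) => ?; [right|left].
(* Both edges occur at a common finite stage [n], where [L n ++ R n] has no repetition. *)
have injp k l : p k = p l -> k = l.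
  pose N k := match k with Posz i => i | Negz i => i end.
  pose n := (maxn (N k) (N l)).+1.
  have kn : N k < n by rewrite ltnS leq_maxl.
  have ln : N l < n by rewrite ltnS leq_maxr.
  have := uLR n; rewrite cat_uniq => /and3P[uL /hasPn LR uR].
  have memR i : i < n -> ray_edge e0 R i \in R n.
    move=> i_n; rewrite -(nth_chain e0 growR (leq_trans i_n (chain_size growR n))).
    exact/mem_nth/(leq_trans i_n (chain_size growR n)).
  have memL i : i < n -> ray_edge e0 L i \in L n.
    move=> i_n; rewrite -(nth_chain e0 growL (leq_trans i_n (chain_size growL n))).
    exact/mem_nth/(leq_trans i_n (chain_size growL n)).
  have injR i j : i < n -> j < n -> ray_edge e0 R i = ray_edge e0 R j -> i = j.
    move=> i_n j_n; have szi := leq_trans i_n (chain_size growR n).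
    have szj := leq_trans j_n (chain_size growR n).
    rewrite -(nth_chain e0 growR szi) -(nth_chain e0 growR szj) => /eqP.
    by rewrite nth_uniq // => /eqP.
  have injL i j : i < n -> j < n -> ray_edge e0 L i = ray_edge e0 L j -> i = j.
    move=> i_n j_n; have szi := leq_trans i_n (chain_size growL n).
    have szj := leq_trans j_n (chain_size growL n).
    rewrite -(nth_chain e0 growL szi) -(nth_chain e0 growL szj) => /eqP.
    by rewrite nth_uniq // => /eqP.
  case: k l @n kn ln {uL uR} LR memR memL injR injL =>
    [i|i] [j|j] n /= kn ln LR memR memL injR injL.
  - by move/injR => ->.
  - by move=> eq_ij; have /LR := memR _ kn; rewrite /= eq_ij memL.
  - by move=> eq_ij; have /LR := memR _ ln; rewrite /= -eq_ij memL.
  - by move/injL => ->.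
move=> e; set v := (endpoints e).1.
have : e \in L v.+1 ++ R v.+1 by apply: cover; rewrite mem_star /inc eqxx.
rewrite mem_cat => /orP[/(mem_chain e0 growL)|/(mem_chain e0 growR)] [i <-].
  by exists (Negz i); split=> // k pk; apply: injp.
by exists (Posz i); split=> // k pk; apply: injp.
Qed.

End EvenEulerian.

(** * The parity criterion *)

Section Characterization.
Variable G : multigraph.

Lemma reachable_reach u v : reachable G u v <-> @reach G [::] u v.
Proof.
split=> [|[s]].
  elim=> [x y [e /joinsP[iex <-]]|x|x y z _ xy _ yz].
  - exact: reach_other.
  - exact: reach_refl.
  - exact: reach_trans xy yz.
elim: s u => [u /eqP-> _|e s IH u /= /andP[ieu ws] sX]; first exact: rt_refl.
apply: (rt_trans _ _ _ (other e u)); last exact: IH ws sX.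
by apply: rt_step; exists e; apply/joinsP.
Qed.

Lemma reachable_delete (X : seq (edge G)) u v :
  reachable (delete_edges [set` X]) u v <-> reach X u v.
Proof.
split=> [|[s]].
  elim=> [x y [[e eX] /= jxy]|x|x y z _ xy _ yz].
  - have /joinsP[iex <-] : joins e x y by [].
    by apply: reach_other => //; apply: contra (eX) => /mem_set.
  - exact: reach_refl.
  - exact: reach_trans xy yz.
elim: s u => [u /eqP-> _|e s IH u /= /andP[ieu ws] /andP[eX sX]].
  exact: rt_refl.
apply: (rt_trans _ _ _ (other e u)); last exact: IH ws sX.
have eF : e \notin [set` X] by apply/negP => /set_mem; apply/negP.
apply: rt_step; exists (exist _ e eF).
by have : joins e u (other e u) by apply/joinsP.
Qed.

Lemma component_delete (X : seq (edge G)) u :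
  component (delete_edges [set` X]) u = reach X u.
Proof. by apply/funext => v; apply/propext; exact: reachable_delete. Qed.

Lemma infinite_reach_vertex (X : seq (edge G)) u :
  infinite_set (reach X u) -> vertices G u.
Proof.
move=> inf; apply: contrapT => nu; apply: inf.
apply: (@sub_finite_set _ _ [set u]); last exact: finite_set1.
move=> v [[|e s] /=]; first by move=> /eqP->.
by case/andP=> /vertices_inc.
Qed.

(** The infinite components inject into the one-element set [I_1], so any two of them are equal. *)
Lemma one_end_reach : ends_at_most G 1 -> forall (X : seq (edge G)) u v,
  infinite_set (reach X u) -> infinite_set (reach X v) -> reach X u v.
Proof.
move=> e1 X u v infu infv.
have /pcard_leP[f] := e1 [set` X] (finite_seq X).
suff -> : reach X u = reach X v by exact: reach_refl.
have mem w : infinite_set (reach X w) ->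
    reach X w \in infinite_components (delete_edges [set` X]).
  move=> inf; apply/mem_set; split=> //; exists w => /=.
    exact: infinite_reach_vertex inf.
  by rewrite component_delete.
apply: (@inj _ _ _ f); [exact: mem|exact: mem|].
have f0 w : infinite_set (reach X w) -> f (reach X w) = 0.
  move=> /mem /set_mem /(@funS _ _ _ _ f) /=.
  by case: (f _).
exact: etrans (f0 u infu) (esym (f0 v infv)).
Qed.

Lemma reachable_inc F v u : reachable (@delete_edges G F) v u ->
  u = v \/ exists e : edge G, inc e u.
Proof.
elim=> [x y [e jxy]|x|x y z _ [->|xy] _ [->|yz]]; try by [left|right].
by right; exists (val e); have : joins (val e) x y by []; exact: inc_joins.
Qed.

(** If [X] contained every edge, each component would consist of its base vertex and ends of edges
    of [X], hence be finite. *)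
Lemma not_ends0_infinite_edges : ~ ends_at_most G 0 ->
  forall X : seq (edge G), exists e, e \notin X.
Proof.
move=> n0 X; apply: contrapT => allX; apply: n0 => F _.
rewrite II0 card_le0; apply/eqP/seteqP; split=> // C [[v _ ->]]; apply.
apply: (@sub_finite_set _ _ [set` v :: flatten
  [seq [:: (endpoints e).1; (endpoints e).2] | e <- X]]); last exact: finite_seq.
move=> u /reachable_inc[->|[e ieu]] /=; first by rewrite mem_head.
rewrite inE; apply/orP; right; apply/flattenP.
exists [:: (endpoints e).1; (endpoints e).2]; last by rewrite !inE.
apply/mapP; exists e => //; apply: contrapT => /negP eX.
by apply: allX; exists e.
Qed.

Hypothesis lfG : locally_finite G.

Lemma finite_incident v : finite_set (incident_edges G v).
Proof.
have [/lfG//|nv] := pselect (vertices G v).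
apply: (sub_finite_set _ (@finite_set0 (edge G))) => e [u /joinsP[iev _]].
exact/nv/(vertices_inc iev).
Qed.

Lemma finite_edges_between u v : finite_set (edges_between G u v).
Proof. by apply: sub_finite_set (finite_incident u) => e; exists v. Qed.

Definition star v : seq (edge G) := fset_set (incident_edges G v).

Lemma star_uniq v : uniq (star v).
Proof. exact: fset_uniq. Qed.

Lemma mem_star v e : (e \in star v) = inc e v.
Proof.
rewrite in_fset_set; last exact: finite_incident.
apply/idP/idP => [/set_mem[u /joinsP[]]//|iev].
by apply/mem_set; exists (other e v); apply/joinsP.
Qed.

(** Each edge contributes its number of ends at [v], the form required by the double counting in
    [even_cut]. *)
Lemma degreeE v : degree G v =
  \sum_(e <- star v) ((v == (endpoints e).1) + (v == (endpoints e).2)).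
Proof.
rewrite /degree -/(star v).
have -> : #|` fset_set (edges_between G v v)| =
    count (fun e => (v == (endpoints e).1) && (v == (endpoints e).2)) (star v).
  rewrite -size_filter; apply/perm_size/uniq_perm.
  - exact: fset_uniq.
  - exact/filter_uniq/star_uniq.
  move=> e; rewrite in_fset_set ?mem_filter ?mem_star; last first.
    exact: finite_edges_between.
  rewrite /inc; apply/idP/idP => [/set_mem|/andP[/andP[/eqP e1 /eqP e2] _]].
    by rewrite /edges_between /joins /=; case=> ->; rewrite /= eqxx.
  by apply/mem_set; left; rewrite {1}e1 e2 -surjective_pairing.
rewrite -sum1_size -sum1_count [X in _ + X]big_mkcond /= -big_split /=.
apply: eq_big_seq => e; rewrite mem_star /inc.
by case: eqP => _ /=; [case: eqP|move=> /eqP <-; rewrite eqxx].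
Qed.

(** [N] collects the departures from [v] and [N1] the arrivals. The edges at [v] are the image of
    their union and the loops that of their intersection, so the degree is the sum of the two
    cardinals. These agree, [N1] being a shift of [N]. *)
Lemma eulerian_even v : two_way_eulerian G -> ~~ odd (degree G v).
Proof.
case=> x [p [jp pE]].
have pinj : injective p.
  by move=> m n pmn; have [k [_ kU]] := pE (p m); rewrite -(kU m) // -(kU n).
pose N := [set n : int | x n = v]; pose N1 := [set n : int | x (n + 1)%R = v].
have fin (A : set int) : p @` A `<=` incident_edges G v -> finite_set A.
  move=> Av; apply: (@sub_finite_set _ _ (p @^-1` incident_edges G v)).
    by move=> n An; apply: Av; exists n.
  by apply: finite_preimage (finite_incident v) => m n _ _ /pinj.
have finN : finite_set N.
  by apply: fin => _ [n <- <-]; exists (x (n + 1)%R).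
have finN1 : finite_set N1.
  apply: fin => _ [n <- <-]; exists (x n).
  by case: (jp n) => ?; [right|left].
have incE : incident_edges G v = p @` (N `|` N1).
  apply/seteqP; split=> [e [u jev]|_ [n + <-]].
    have [n [pn _]] := pE e; exists n => //; rewrite -pn in jev.
    move: (jp n) jev; rewrite /edges_between /joins /= => -[] -> [] [] *;
      by [left|right].
  case=> nv; first by exists (x (n + 1)%R); rewrite -nv.
  by exists (x n); rewrite -nv; case: (jp n) => ?; [right|left].
have loopE : edges_between G v v = p @` (N `&` N1).
  apply/seteqP; split=> [e jev|_ [n [nv n1v] <-]].
    have [n [pn _]] := pE e; exists n => //; rewrite -pn in jev.
    by move: (jp n) jev; rewrite /edges_between /joins /= => -[] -> [] [] *; split.
  by rewrite /edges_between /= -{1}nv -n1v.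
have finNN1 : finite_set (N `&` N1) by apply: finite_setIl.
rewrite /degree incE loopE !fset_set_image ?finite_setU //.
rewrite !card_imfset //= fset_setU // fset_setI // cardfsUI.
have -> : N1 = (fun n => n - 1)%R @` N.
  apply/seteqP; split=> [n n1|_ [n nN <-]].
    by exists (n + 1)%R => //; rewrite GRing.addrK.
  by rewrite /N1 /= GRing.subrK.
rewrite fset_set_image // card_imfset /=; last exact: GRing.addIr.
by rewrite addnn odd_double.
Qed.

Lemma two_way_eulerianP : connected_graph G -> has_number_of_ends G 1 ->
  two_way_eulerian G <-> forall v, ~~ odd (degree G v).
Proof.
move=> [[a va] conn] [e1 e_min]; split=> [h v|even]; first exact: eulerian_even.
(* Having one end and not zero ends is what provides infinitely many edges. *)
have n0 : ~ ends_at_most G 0 by move/e_min.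
apply: (@even_two_way_eulerian G star a star_uniq mem_star).
- by move=> v; rewrite -degreeE.
- exact: one_end_reach.
- by move=> e; apply/reachable_reach/conn => //; have [] := endpointsP e.
- exact: not_ends0_infinite_edges.
Qed.

End Characterization.

(** * Closure properties of the recursive functions *)

Lemma eq_recursive k (f g : k.-tuple nat -> nat) :
  f =1 g -> recursive f -> recursive g.
Proof. by move=> /funext->. Qed.

Lemma recursive_nth k i : i < k -> @recursive k (fun x => nth 0 x i).
Proof.
move=> ik; apply: eq_recursive (rec_proj (Ordinal ik)) => x.
by rewrite (tnth_nth 0).
Qed.

Lemma recursive_comp1 k (g : nat -> nat) (f : k.-tuple nat -> nat) :
  computable1 g -> recursive f -> recursive (fun x => g (f x)).
Proof.
move=> rg rf; apply: eq_recursive (rec_comp rg (fun=> rf)) => x.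
by rewrite (nth_mktuple _ _ (Ordinal (isT : 0 < 1))).
Qed.

Lemma recursive_comp2 k (g : nat -> nat -> nat) (f1 f2 : k.-tuple nat -> nat) :
  computable2 g -> recursive f1 -> recursive f2 ->
  recursive (fun x => g (f1 x) (f2 x)).
Proof.
move=> rg r1 r2; pose h (i : 'I_2) := if val i is 0 then f1 else f2.
have rh i : recursive (h i) by case: i => -[].
apply: eq_recursive (rec_comp rg rh) => x.
by rewrite (nth_mktuple _ _ (Ordinal (isT : 0 < 2)))
  (nth_mktuple _ _ (Ordinal (isT : 1 < 2))).
Qed.

Lemma recursive_succ k (f : k.-tuple nat -> nat) :
  recursive f -> recursive (fun x => (f x).+1).
Proof.
by apply: recursive_comp1; apply: eq_recursive rec_succ => x; case/tupleP: x.
Qed.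

Lemma recursive_const k n : @recursive k (fun=> n).
Proof. by elim: n => [|n IH]; [exact: rec_zero|exact: recursive_succ]. Qed.

Lemma computable2_prim (f : nat -> nat -> nat) (g : nat -> nat)
    (h : nat -> nat -> nat -> nat) :
  computable1 g -> computable3 h -> f 0 =1 g ->
  (forall n y, f n.+1 y = h n (f n y) y) -> computable2 f.
Proof.
move=> rg rh f0 fS; apply: eq_recursive (rec_prim rg rh) => x.
case/tupleP: x => n y; rewrite theadE.
have -> : [tuple of behead [tuple of n :: y]] = y by apply: val_inj.
by elim: n => [|n IH] /=; rewrite ?f0 ?fS ?IH.
Qed.

Lemma computable2_add : computable2 addn.
Proof.
apply: (@computable2_prim _ id (fun _ a _ => a.+1)) => //.
- exact: recursive_nth.
- exact/recursive_succ/recursive_nth.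
Qed.

Lemma recursive_add k (f g : k.-tuple nat -> nat) :
  recursive f -> recursive g -> recursive (fun x => f x + g x).
Proof. exact/recursive_comp2/computable2_add. Qed.

Lemma recursive_mul k (f g : k.-tuple nat -> nat) :
  recursive f -> recursive g -> recursive (fun x => f x * g x).
Proof.
apply: recursive_comp2.
apply: (@computable2_prim _ (fun=> 0) (fun _ a y => y + a)) => //.
- exact: recursive_const.
- by apply: recursive_add; apply: recursive_nth.
Qed.

Lemma recursive_pred k (f : k.-tuple nat -> nat) :
  recursive f -> recursive (fun x => (f x).-1).
Proof.
move=> rf; suff h : computable2 (fun n _ => n.-1) by apply: (recursive_comp2 h rf rf).
apply: (@computable2_prim _ (fun=> 0) (fun n _ _ => n)) => //.
- exact: recursive_const.
- exact: recursive_nth.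
Qed.

Lemma recursive_sub k (f g : k.-tuple nat -> nat) :
  recursive f -> recursive g -> recursive (fun x => f x - g x).
Proof.
(* [computable2_prim] recurses on the first argument, so the subtrahend comes first. *)
move=> rf rg; suff h : computable2 (fun n y => y - n).
  exact: (recursive_comp2 h rg rf).
apply: (@computable2_prim _ id (fun _ a _ => a.-1)) => //.
- exact: recursive_nth.
- exact/recursive_pred/recursive_nth.
- by move=> y; rewrite subn0.
- by move=> n y; rewrite subnS.
Qed.

Lemma recursive_iter k (s : nat -> nat) (f g : k.-tuple nat -> nat) :
  computable1 s -> recursive f -> recursive g ->
  recursive (fun x => iter (f x) s (g x)).
Proof.
move=> rs; apply: (@recursive_comp2 _ (fun n y => iter n s y)).
apply: (@computable2_prim _ id (fun _ a _ => s a)) => //.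
- exact: recursive_nth.
- exact/recursive_comp1/recursive_nth.
Qed.

Lemma recursive_neq0 k (f : k.-tuple nat -> nat) :
  recursive f -> recursive (fun x => nat_of_bool (f x != 0)).
Proof.
move=> rf; apply: (@eq_recursive _ (fun x => 1 - (1 - f x))).
  by move=> x; case: (f x) => //= n; rewrite subSS sub0n.
by apply/recursive_sub/recursive_sub => //; apply: recursive_const.
Qed.

Lemma recursive_negb k (f : k.-tuple nat -> bool) :
  recursive (fun x => nat_of_bool (f x)) ->
  recursive (fun x => nat_of_bool (~~ f x)).
Proof.
move=> rf; apply: (@eq_recursive _ (fun x => 1 - f x)).
  by move=> x; case: (f x).
exact/recursive_sub/rf/recursive_const.
Qed.

Lemma recursive_if k (b : k.-tuple nat -> bool) (f g : k.-tuple nat -> nat) :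
  recursive (fun x => nat_of_bool (b x)) -> recursive f -> recursive g ->
  recursive (fun x => if b x then f x else g x).
Proof.
move=> rb rf rg; apply: (@eq_recursive _ (fun x => b x * f x + ~~ b x * g x)).
  by move=> x; case: (b x); rewrite mul1n mul0n ?addn0.
by apply: recursive_add; apply: recursive_mul => //; apply: recursive_negb.
Qed.

Lemma recursive_eq k (f g : k.-tuple nat -> nat) :
  recursive f -> recursive g -> recursive (fun x => nat_of_bool (f x == g x)).
Proof.
move=> rf rg.
apply: (@eq_recursive _ (fun x => nat_of_bool (~~ ((f x - g x) + (g x - f x) != 0)))).
  by move=> x; rewrite negbK addn_eq0 !subn_eq0 -eqn_leq.
by apply: recursive_negb; apply: recursive_neq0; apply: recursive_add;
  apply: recursive_sub.
Qed.

Lemma recursive_odd k (f : k.-tuple nat -> nat) :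
  recursive f -> recursive (fun x => nat_of_bool (odd (f x))).
Proof.
move=> rf; apply: (@recursive_comp1 _ (fun n => odd n)) => //.
have r : recursive (fun x : 1.-tuple nat => iter (nth 0 x 0) (fun b => 1 - b) 0).
  apply: (@recursive_iter _ (fun b => 1 - b)).
  - exact/recursive_sub/recursive_nth/isT/recursive_const.
  - exact: recursive_nth.
  - exact: recursive_const.
by apply: eq_recursive r => x; elim: (nth 0 x 0) => //= n ->; case: (odd n).
Qed.

Lemma recursive_switch k (t a : k.-tuple nat -> nat) (s : k.-tuple nat -> seq nat) :
  recursive t -> recursive a -> recursive (fun x => nth 0 (s x) (t x).-1) ->
  recursive (fun x => nth 0 (a x :: s x) (t x)).
Proof.
move=> rt ra rs.
apply: (@eq_recursive _ (fun x => if t x == 0 then a x else nth 0 (s x) (t x).-1)).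
  by move=> x; case: (t x).
by apply: recursive_if => //; apply: recursive_eq => //; apply: recursive_const.
Qed.

(** * A pairing function *)

(** The condition is written as a test for zero to fit [rec_min]. *)
Lemma sqrt_exists n : exists r, n.+1 - r.+1 * r.+1 == 0.
Proof. by exists n; rewrite subn_eq0 leq_pmulr. Qed.

Definition sqrtn n := ex_minn (sqrt_exists n).

Lemma sqrtnE n r : r * r <= n < r.+1 * r.+1 -> sqrtn n = r.
Proof.
rewrite /sqrtn => /andP[rn nr]; case: ex_minnP => m.
rewrite subn_eq0 => nm m_min; apply/eqP; rewrite eqn_leq m_min ?subn_eq0 //=.
rewrite leqNgt; apply/negP => mr.
by have := leq_trans nm (leq_trans (leq_mul mr mr) rn); rewrite ltnn.
Qed.

(** The value lies between the squares of [a + b] and [a + b + 1], so the integer square root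
    recovers [a + b] and the remainder is [a]. The pairing is injective but not onto. *)
Definition pairn a b := (a + b) * (a + b) + a.
Definition fstn n := n - sqrtn n * sqrtn n.
Definition sndn n := sqrtn n - fstn n.

Lemma sqrtn_pairn a b : sqrtn (pairn a b) = a + b.
Proof.
apply: sqrtnE; rewrite leq_addr /= /pairn mulSn mulnS addSn ltnS.
by rewrite addnA [leqLHS]addnC leq_add2r -addnA leq_addr.
Qed.

Lemma fstn_pairn a b : fstn (pairn a b) = a.
Proof. by rewrite /fstn sqrtn_pairn addKn. Qed.

Lemma sndn_pairn a b : sndn (pairn a b) = b.
Proof. by rewrite /sndn fstn_pairn sqrtn_pairn addKn. Qed.

Lemma recursive_pairn k (f g : k.-tuple nat -> nat) :
  recursive f -> recursive g -> recursive (fun x => pairn (f x) (g x)).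
Proof.
by move=> rf rg; apply: recursive_add => //; apply: recursive_mul;
  apply: recursive_add.
Qed.

Lemma computable1_sqrtn : computable1 sqrtn.
Proof.
apply: (@rec_min 1 (fun z => (nth 0 z 1).+1 - (nth 0 z 0).+1 * (nth 0 z 0).+1)).
apply: recursive_sub; first exact/recursive_succ/recursive_nth.
by apply: recursive_mul; apply/recursive_succ/recursive_nth.
Qed.

Lemma recursive_fstn k (f : k.-tuple nat -> nat) :
  recursive f -> recursive (fun x => fstn (f x)).
Proof.
move=> rf; apply: recursive_sub => //.
by apply: recursive_mul; apply: recursive_comp1 rf; apply: computable1_sqrtn.
Qed.

Lemma recursive_sndn k (f : k.-tuple nat -> nat) :
  recursive f -> recursive (fun x => sndn (f x)).
Proof.
move=> rf; apply: recursive_sub; last exact: recursive_fstn.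
exact: recursive_comp1 computable1_sqrtn rf.
Qed.

(** * A universal stack machine *)

Definition consn i K := (pairn i K).+1.

(* A configuration is [pairn K v]: a control stack [K] of instructions, coded by
   [0] and [consn], and a current value [v]. Instruction [pairn tag arg] has tag
   0-5 for identity, zero, successor, predecessor, first and second projection,
   6 for composition, 7 for pairing, 10 for "while the first component is
   nonzero". Tags 8 and 9 occur only on the stack, as the continuations of 7. *)
Definition exec tag arg K v :=
  nth 0 [:: pairn K v; pairn K 0; pairn K v.+1; pairn K v.-1;
            pairn K (fstn v); pairn K (sndn v);
            pairn (consn (sndn arg) (consn (fstn arg) K)) v;
            pairn (consn (fstn arg) (consn (pairn 8 (pairn (sndn arg) v)) K)) v;
            pairn (consn (fstn arg) (consn (pairn 9 v) K)) (sndn arg);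
            pairn K (pairn arg v);
            if fstn v == 0 then pairn K v
            else pairn (consn arg (consn (pairn 10 arg) K)) v] tag.

(** An empty control stack means that the machine has halted; such configurations are fixed
    points. *)
Definition step z :=
  let i := fstn (fstn z).-1 in
  if fstn z == 0 then z
  else exec (fstn i) (sndn i) (sndn (fstn z).-1) (sndn z).

Lemma step_consn tag arg K v :
  step (pairn (consn (pairn tag arg) K) v) = exec tag arg K v.
Proof. by rewrite /step !(fstn_pairn, sndn_pairn). Qed.

Ltac prove_recursive := repeat lazymatch goal with
  | |- recursive (fun x => nth 0 (_ :: _) _) => apply: recursive_switch
  | |- recursive (fun x => nth 0 [::] _) =>
      apply: (@eq_recursive _ (fun=> 0)); first by move=> x; rewrite nth_nil
  | |- recursive (fun x => if _ then _ else _) => apply: recursive_if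
  | |- recursive (fun x => nat_of_bool (_ == _)) => apply: recursive_eq
  | |- recursive (fun x => pairn _ _) => apply: recursive_pairn
  | |- recursive (fun x => fstn _) => apply: recursive_fstn
  | |- recursive (fun x => sndn _) => apply: recursive_sndn
  | |- recursive (fun x => _.+1) => apply: recursive_succ
  | |- recursive (fun x => _.-1) => apply: recursive_pred
  | |- recursive (fun x => nth 0 (tval x) _) => exact: recursive_nth
  | |- recursive (fun x => ?n) => exact: recursive_const
  end.

Lemma computable1_step : computable1 step.
Proof. rewrite /computable1 /step /exec /consn /=; prove_recursive. Qed.

Definition runs z z' := exists n, iter n step z = z'.

Lemma runs_refl z : runs z z.
Proof. by exists 0. Qed.

Lemma runs_trans y x z : runs x y -> runs y z -> runs x z.
Proof. by move=> [m <-] [n <-]; exists (n + m); rewrite iterD. Qed.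

Lemma runs_step x y : runs (step x) y -> runs x y.
Proof. by move=> [n <-]; exists n.+1; rewrite iterSr. Qed.

(** Quantifying over the rest [K] of the stack lets runs of subprograms be chained. *)
Definition ev c a b := forall K, runs (pairn (consn c K) a) (pairn K b).

Lemma ev_exec tag arg a b : (forall K, exec tag arg K a = pairn K b) ->
  ev (pairn tag arg) a b.
Proof. by move=> h K; apply: runs_step; rewrite step_consn h; apply: runs_refl. Qed.

Definition c_id := pairn 0 0.
Definition c_zero := pairn 1 0.
Definition c_succ := pairn 2 0.
Definition c_pred := pairn 3 0.
Definition c_fst := pairn 4 0.
Definition c_snd := pairn 5 0.
Definition c_comp f g := pairn 6 (pairn f g).
Definition c_pair f g := pairn 7 (pairn f g).
Definition c_while f := pairn 10 f.

Lemma ev_id a : ev c_id a a. Proof. exact: ev_exec. Qed.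
Lemma ev_zero a : ev c_zero a 0. Proof. exact: ev_exec. Qed.
Lemma ev_succ a : ev c_succ a a.+1. Proof. exact: ev_exec. Qed.
Lemma ev_pred a : ev c_pred a a.-1. Proof. exact: ev_exec. Qed.

Lemma ev_fst a b : ev c_fst (pairn a b) a.
Proof. by apply: ev_exec => K; rewrite /exec /= fstn_pairn. Qed.

Lemma ev_snd a b : ev c_snd (pairn a b) b.
Proof. by apply: ev_exec => K; rewrite /exec /= sndn_pairn. Qed.

Lemma ev_comp f g a b c : ev g a b -> ev f b c -> ev (c_comp f g) a c.
Proof.
move=> eg ef K; apply: runs_step; rewrite step_consn /exec /=.
rewrite fstn_pairn sndn_pairn; exact: runs_trans (eg _) (ef _).
Qed.

(** While [f] runs, tag 8 keeps [g] and the input [a]; while [g] runs, tag 9 keeps the result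
    [b]. *)
Lemma ev_pair f g a b c : ev f a b -> ev g a c -> ev (c_pair f g) a (pairn b c).
Proof.
move=> ef eg K; apply: runs_step; rewrite step_consn /exec /= fstn_pairn sndn_pairn.
apply: runs_trans (ef _) _; apply: runs_step; rewrite step_consn /exec /=.
rewrite fstn_pairn sndn_pairn; apply: runs_trans (eg _) _.
by apply: runs_step; rewrite step_consn; apply: runs_refl.
Qed.

Lemma ev_while0 f a : ev (c_while f) (pairn 0 a) (pairn 0 a).
Proof. by apply: ev_exec => K; rewrite /exec /= fstn_pairn. Qed.

(** An exact single step, since the divergence argument counts steps. *)
Lemma step_whileS f n a K : step (pairn (consn (c_while f) K) (pairn n.+1 a)) =
  pairn (consn f (consn (c_while f) K)) (pairn n.+1 a).
Proof. by rewrite step_consn /exec /= fstn_pairn. Qed.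

Lemma ev_whileS f n a b c : ev f (pairn n.+1 a) b -> ev (c_while f) b c ->
  ev (c_while f) (pairn n.+1 a) c.
Proof.
by move=> ef ew K; apply: runs_step; rewrite step_whileS;
  exact: runs_trans (ef _) (ew _).
Qed.

Lemma ev_comp_fst c a b r : ev c a r -> ev (c_comp c c_fst) (pairn a b) r.
Proof. exact/ev_comp/ev_fst. Qed.

Lemma ev_comp_snd c a b r : ev c b r -> ev (c_comp c c_snd) (pairn a b) r.
Proof. exact/ev_comp/ev_snd. Qed.

(** * Unbounded search *)

Definition c_search_body f := c_comp (c_pair f c_id)
  (c_comp (c_pair (c_comp c_succ c_fst) c_snd) c_snd).

(* The value during the search is [(f m, (m, x))]. *)
Definition c_search f := c_comp (c_while (c_search_body f))
  (c_comp (c_pair f c_id) (c_pair c_zero c_id)).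

Section Search.
Variables (f x : nat) (phi : nat -> nat).
Hypothesis ev_f : forall m, ev f (pairn m x) (phi m).

Let state m := pairn (phi m) (pairn m x).

Lemma ev_search_init : ev (c_comp (c_pair f c_id) (c_pair c_zero c_id)) x (state 0).
Proof.
apply: (@ev_comp _ _ _ (pairn 0 x)); apply: ev_pair => //.
- exact: ev_zero.
- exact: ev_id.
- exact: ev_id.
Qed.

Lemma ev_search_body m : ev (c_search_body f) (state m) (state m.+1).
Proof.
apply: (@ev_comp _ _ _ (pairn m.+1 x)); last by apply: ev_pair => //; exact: ev_id.
apply: ev_comp_snd; apply: ev_pair; last exact: ev_snd.
exact/ev_comp_fst/ev_succ.
Qed.

Lemma ev_search N : phi N = 0 -> (forall m, m < N -> phi m != 0) ->
  ev (c_search f) x (pairn 0 (pairn N x)).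
Proof.
move=> phiN0 phi_lt; apply: ev_comp ev_search_init _.
(* [j] is the number of iterations left before the zero at [N]. *)
suff loop j m : m + j = N ->
    ev (c_while (c_search_body f)) (state m) (pairn 0 (pairn N x)).
  exact: (loop N 0).
elim: j m => [|j IH] m mN.
  by rewrite -mN addn0 /state -[m]addn0 mN phiN0; exact: ev_while0.
have := ev_search_body m; have /phi_lt : m < N by rewrite -mN addnS ltnS leq_addr.
rewrite /state; case: (phi m) => // p _ body.
by apply: ev_whileS body (IH m.+1 _); rewrite addSnnS.
Qed.

(** The loop head, whose stack is nonempty, recurs at arbitrarily late times, whereas a halted
    configuration would persist forever. *)
Lemma search_diverges : (forall m, phi m != 0) ->
  forall t, fstn (iter t step (pairn (consn (c_search f) 0) x)) != 0.
Proof.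
move=> phi0 t; set z := pairn _ x.
pose head m := pairn (consn (c_while (c_search_body f)) 0) (state m).
have step_halted n y : fstn y = 0 -> iter n step y = y.
  by move=> y0; elim: n => //= n ->; rewrite /step y0.
have [k [m [tk zk]]] : exists k m, t <= k /\ iter k step z = head m.
  elim: t => [|t [k [m [tk zk]]]].
    have [k zk] : runs z (head 0).
      apply: runs_step; rewrite step_consn /exec /= fstn_pairn sndn_pairn.
      exact: ev_search_init.
    by exists k, 0.
  have := ev_search_body m (consn (c_while (c_search_body f)) 0).
  have := phi0 m; case phim: (phi m) => [//|p] _ [n nE].
  exists (n + k.+1), m.+1; split; first by rewrite addnS ltnS (leq_trans tk) ?leq_addl.
  rewrite iterD iterS zk /head /state phim step_whileS -/(state _).
  by rewrite -[RHS]nE /state phim.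
apply/eqP => halted; move: zk; rewrite -(subnK tk) iterD step_halted // => zh.
by move: halted; rewrite zh /head fstn_pairn.
Qed.

End Search.

(** * Compiling recursive functions into machine programs *)

Definition enc (s : seq nat) := foldr pairn 0 s.

Lemma ev_nth i : exists c, forall s, i < size s -> ev c (enc s) (nth 0 s i).
Proof.
elim: i => [|i [c ec]]; first by exists c_fst => -[//|x s] _; exact: ev_fst.
by exists (c_comp c c_snd) => -[//|x s] /= /ec; exact: ev_comp_snd.
Qed.

Section PrimitiveRecursion.
Variables (k : nat) (g : k.-tuple nat -> nat) (h : k.+2.-tuple nat -> nat).
Variables (cg ch : nat).
Hypothesis ev_g : forall x : k.-tuple nat, ev cg (enc x) (g x).
Hypothesis ev_h : forall x : k.+2.-tuple nat, ev ch (enc x) (h x).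

Let body := c_pair (c_comp c_pred c_fst) (c_comp
  (c_pair (c_comp c_succ c_fst) (c_pair ch (c_comp c_snd c_snd))) c_snd).

(* The value during the loop is [(n - m, (m, (primrec g h m x, x)))]. *)
Definition c_primrec := c_comp (c_comp (c_comp c_fst c_snd) c_snd)
  (c_comp (c_while body) (c_pair c_fst (c_comp
    (c_pair c_zero (c_pair cg c_id)) c_snd))).

Lemma ev_primrec n (x : k.-tuple nat) :
  ev c_primrec (pairn n (enc x)) (primrec g h n x).
Proof.
pose state j m := pairn j (pairn m (pairn (primrec g h m x) (enc x))).
apply: (@ev_comp _ _ _ (state 0 n)); last exact/ev_comp_snd/ev_comp_snd/ev_fst.
apply: (@ev_comp _ _ _ (state n 0)).
  apply: ev_pair; first exact: ev_fst.
  apply: ev_comp_snd; apply: ev_pair; first exact: ev_zero.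
  by apply: ev_pair; [exact: ev_g|exact: ev_id].
suff loop j m : m + j = n -> ev (c_while body) (state j m) (state 0 n).
  exact: (loop n 0).
elim: j m => [|j IH] m mn.
  by rewrite -mn addn0; exact: ev_while0.
apply: (ev_whileS _ (IH m.+1 _)); last by rewrite addSnnS.
apply: ev_pair; first exact/ev_comp_fst/ev_pred.
apply: ev_comp_snd; apply: ev_pair; first exact/ev_comp_fst/ev_succ.
apply: ev_pair; last exact/ev_comp_snd/ev_snd.
exact: (ev_h [tuple of m :: primrec g h m x :: x]).
Qed.

End PrimitiveRecursion.

Lemma recursive_ev k (f : k.-tuple nat -> nat) : recursive f ->
  exists c, forall x : k.-tuple nat, ev c (enc x) (f x).
Proof.
elim=> {k f} [k||k i|k m g h _ [cg eg] _ eh|k g h _ [cg eg] _ [ch eh]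
  |k f f_reg _ [c ec]].
- by exists c_zero => x; exact: ev_zero.
- exists (c_comp c_succ c_fst) => x; case/tupleP: x => n y.
  by rewrite theadE; exact/ev_comp_fst/ev_succ.
- have [c ec] := ev_nth i; exists c => x.
  by rewrite (tnth_nth 0); apply: ec; rewrite size_tuple.
(* One program computes the encoded tuple of all inner functions, by iterated pairing. *)
- have [d ed] : exists d, forall x : k.-tuple nat,
      ev d (enc x) (enc [seq h i x | i <- enum 'I_m]).
    elim: (enum _) => [|i s [d ed]]; first by exists c_zero => x; exact: ev_zero.
    by have [c ec] := eh i; exists (c_pair c d) => x; exact: ev_pair.
  exists (c_comp cg d) => x; apply: ev_comp (ed x) _.
  by have := eg [tuple h i x | i < m]; rewrite /= /codom_tuple.
- exists (c_primrec cg ch) => x; case/tupleP: x => n y.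
  rewrite theadE; have -> : [tuple of behead [tuple of n :: y]] = y by apply: val_inj.
  exact: ev_primrec.
- exists (c_comp (c_comp c_fst c_snd) (c_search c)) => x.
  case: ex_minnP => N /eqP fN N_min.
  apply: (@ev_comp _ _ _ (pairn 0 (pairn N (enc x)))); last exact/ev_comp_snd/ev_fst.
  apply: (@ev_search _ _ (fun m => f [tuple of m :: x])) => // [m|m mN].
    exact: (ec [tuple of m :: x]).
  by apply/negP => /N_min; rewrite leqNgt mN.
Qed.

(** [z] codes a program with its input; the test asks whether the machine is still running after [n]
    steps. *)
Definition runs_on z n : bool :=
  fstn (iter n step (pairn (consn (fstn z) 0) (sndn z))) != 0.

Lemma computable2_runs_on : computable2 runs_on.
Proof.
apply: recursive_neq0; apply: recursive_fstn; apply: recursive_iter.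
- exact: computable1_step.
- exact: recursive_nth.
- rewrite /consn; prove_recursive.
Qed.

(** An element [x] is sent to the search for a number [m] at which [R x m] fails, which runs forever
    exactly when [x] is in [B]. *)
Lemma runs_on_Pi01_hard (B : set nat) : Pi01 B ->
  many_one_reducible B [set z | forall n, runs_on z n].
Proof.
move=> [R [/recursive_ev[cR eR] BE]].
(* The search supplies [pairn m x], so the arguments are swapped and closed with the final 0 of
   [enc]. *)
pose c := c_comp cR (c_pair c_snd (c_pair c_fst c_zero)).
have ec x m : ev c (pairn m x) (R x m).
  apply: (@ev_comp _ _ _ (enc [tuple x; m])); last exact: (eR [tuple x; m]).
  apply: ev_pair; first exact: ev_snd.
  by apply: ev_pair; [exact: ev_fst|exact: ev_zero].
exists (pairn (c_search c)); split.
  by apply: recursive_pairn; [exact: recursive_const|exact: recursive_nth].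
move=> x; rewrite BE /=; split=> [allR n|run n].
  rewrite /runs_on fstn_pairn sndn_pairn; apply: (search_diverges (ec x)) => m.
  by rewrite allR.
apply: contrapT => /negP nR.
have [N /negP nRN N_min] := ex_minnP (ex_intro (fun n => ~~ R x n) n nR).
have [||t tE] := @ev_search c x (fun m => R x m) (ec x) N _ _ 0.
- by move/negP: nRN; case: (R x N).
- move=> m mN; suff -> : R x m by [].
  by apply: contraT => /N_min; rewrite leqNgt mN.
by have := run t; rewrite /runs_on fstn_pairn sndn_pairn tE fstn_pairn.
Qed.

(** * Rays with simple and double edges *)

Lemma card_fset_seq (T : choiceType) (s : seq T) :
  uniq s -> #|` fset_set [set` s]| = size s.
Proof.
move=> us; apply/perm_size/uniq_perm => // x.
rewrite in_fset_set; last exact: finite_seq.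
by apply/idP/idP => [/set_mem|/mem_set].
Qed.

Section Ray.
Variable d : nat -> bool.

(** The pair [(n, false)] is the edge from [n] to [n.+1] that is always present; [(n, true)] is its
    double, present only when [d n] holds. *)
Definition ray_graph : multigraph :=
  @Multigraph setT {p : nat * bool | p.2 ==> d p.1}
    (fun e => ((val e).1, (val e).1.+1)) (fun=> conj I I).

Definition ray_edges n : seq (edge ray_graph) :=
  pmap insub [:: (n, false); (n, true)].

Lemma ray_edges_uniq n : uniq (ray_edges n).
Proof. by apply: pmap_sub_uniq; rewrite /= inE xpair_eqE andbF. Qed.

Lemma size_ray_edges n : size (ray_edges n) = (d n).+1.
Proof. by rewrite size_pmap_sub /= addn0. Qed.

Lemma mem_ray_edges n e : (e \in ray_edges n) = ((val e).1 == n).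
Proof.
rewrite mem_pmap_sub !inE; case: (val e) => m b; rewrite !xpair_eqE /=.
by case: b; rewrite !(andbT, andbF, orbF).
Qed.

Lemma ray_joins (e : edge ray_graph) u v : joins e u v <->
  (val e).1 = u /\ v = u.+1 \/ (val e).1 = v /\ u = v.+1.
Proof.
rewrite /joins /=; split=> [[[<- <-]|[<- <-]]|[[<- ->]|[<- ->]]]; by [left|right].
Qed.

Lemma edges_between_ray u v : edges_between ray_graph u v =
  [set` if v == u.+1 then ray_edges u else if u == v.+1 then ray_edges v else [::]].
Proof.
apply/seteqP; split=> e /=.
  case/ray_joins=> -[eE ->]; first by rewrite eqxx mem_ray_edges eE.
  by rewrite ltn_eqF // eqxx mem_ray_edges eE.
case: eqP => [-> |_]; last case: eqP => [->|//].
  by rewrite mem_ray_edges => /eqP eE; apply/ray_joins; left.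
by rewrite mem_ray_edges => /eqP eE; apply/ray_joins; right.
Qed.

Lemma incident_edges_ray v : incident_edges ray_graph v =
  [set` ray_edges v ++ if v is u.+1 then ray_edges u else [::]].
Proof.
apply/seteqP; split=> e /=; rewrite mem_cat mem_ray_edges.
  case=> u /ray_joins[[-> _]|[eE ->]]; first by rewrite eqxx.
  by rewrite mem_ray_edges eE eqxx orbT.
case/orP=> [/eqP eE|]; first by exists v.+1; apply/ray_joins; left.
case: v => // u; rewrite mem_ray_edges => /eqP eE.
by exists u; apply/ray_joins; right.
Qed.

Lemma nb_edges_ray u v : nb_edges ray_graph u v =
  if v == u.+1 then (d u).+1 else if u == v.+1 then (d v).+1 else 0.
Proof.
rewrite /nb_edges edges_between_ray card_fset_seq.
  by case: ifP => _; [|case: ifP => _]; rewrite ?size_ray_edges.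
by case: ifP => _; [|case: ifP => _]; rewrite ?ray_edges_uniq.
Qed.

Lemma degree_ray v : degree ray_graph v =
  (d v).+1 + if v is u.+1 then (d u).+1 else 0.
Proof.
rewrite /degree edges_between_ray incident_edges_ray !card_fset_seq.
- rewrite ltn_eqF // addn0 size_cat size_ray_edges.
  by case: v => // u; rewrite size_ray_edges.
- by rewrite ltn_eqF.
rewrite cat_uniq ray_edges_uniq /=; case: v => // u; rewrite ray_edges_uniq andbT.
by apply/hasPn => e; rewrite !mem_ray_edges => /eqP->; rewrite ltn_eqF.
Qed.

(** Vertex 0 meets only the first bundle of edges, so that bundle is double; evenness at [n.+1]
    passes this on from bundle [n] to bundle [n.+1]. *)
Lemma even_degree_ray :
  (forall v, ~~ odd (degree ray_graph v)) <-> forall n, d n.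
Proof.
split=> [even|dT v]; last by rewrite degree_ray dT; case: v => // u; rewrite dT.
elim=> [|n IH]; first by have := even 0; rewrite degree_ray addn0 /= oddb negbK.
by have := even n.+1; rewrite degree_ray IH oddD /= oddb addbF negbK.
Qed.

Lemma locally_finite_ray : locally_finite ray_graph.
Proof. by move=> v _; rewrite incident_edges_ray; exact: finite_seq. Qed.

Lemma reach_ray (X : seq (edge ray_graph)) N n :
  {in X, forall e, (val e).1 < N} -> N <= n -> reach X N n.
Proof.
move=> XN /subnKC <-; elim: (n - N) => [|j IH].
  by rewrite addn0; exact: reach_refl.
apply: reach_trans IH _.
have ed : (N + j, false).2 ==> d (N + j, false).1 by [].
pose e : edge ray_graph := exist _ (N + j, false) ed.
have -> : N + j.+1 = other e (N + j) by rewrite /other /= eqxx addnS.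
apply: reach_other; last by rewrite /inc /= eqxx.
by apply/negP => /XN; rewrite /= ltnNge leq_addr.
Qed.

Lemma connected_ray : connected_graph ray_graph.
Proof.
split; first by exists 0.
move=> u v _ _; apply/reachable_reach; apply: (@reach_trans _ _ _ 0).
  by apply/reach_sym/reach_ray.
exact: reach_ray.
Qed.

Lemma ends_ray : has_number_of_ends ray_graph 1.
Proof.
split=> [F /finite_seqP[X ->]|k ek].
  (* No edge beyond [N] is deleted, so every infinite component contains the tail from [N] on. *)
  pose N := (\max_(e <- X) (val e).1).+1.
  have XN : {in X, forall e, (val e).1 < N}.
    by move=> e eX; rewrite ltnS; apply: (bigmax_sup_seq _ eX).
  apply: (@card_le_trans _ _ _ [set reach X N]); last first.
    by have := @card_set1 _ (reach X N); rewrite card_eq_le => /andP[].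
  apply: subset_card_le => C [[v _ ->]]; rewrite component_delete => infv.
  have [n vn Nn] : exists2 n, reach X v n & N <= n.
    apply: contrapT => nN; apply: infv; apply: sub_finite_set (finite_II N).
    move=> n vn /=; rewrite ltnNge; apply/negP => Nn.
    by apply: nN; exists n.
  by rewrite /= (reach_eq vn) (reach_eq (reach_ray XN Nn)).
(* The bound 0 already fails when no edge is deleted. *)
case: k ek => // /(_ [set` [::]] (finite_seq _)).
rewrite II0 card_le0 => /eqP no_comp.
suff : set0 (@reach ray_graph [::] 0) by [].
rewrite -no_comp; split; first by exists 0 => //; rewrite component_delete.
apply: (sub_infinite_set _ infinite_nat) => n _; exact: reach_ray.
Qed.

End Ray.

Theorem theorem4p6 :
  (forall G : nat -> multigraph,
     uniformly_highly_computable G ->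
     (forall e, [/\ connected_graph (G e), locally_finite (G e)
                  & has_number_of_ends (G e) 1]) ->
     Pi01 [set e | two_way_eulerian (G e)]) /\
  (exists G : nat -> multigraph,
     [/\ uniformly_highly_computable G,
         forall e, [/\ connected_graph (G e), locally_finite (G e)
                     & has_number_of_ends (G e) 1]
       & Pi01_complete [set e | two_way_eulerian (G e)]]).
Proof.
have PiE (G : nat -> multigraph) : uniformly_highly_computable G ->
    (forall e, [/\ connected_graph (G e), locally_finite (G e)
                 & has_number_of_ends (G e) 1]) ->
    Pi01 [set e | two_way_eulerian (G e)].
  move=> [_ _ _ rdeg] hG; exists (fun e v => ~~ odd (degree (G e) v)); split.
    exact/recursive_negb/recursive_odd.
  by move=> e; have [conn lf ends] := hG e; apply: two_way_eulerianP.
split=> //; pose G z := ray_graph (runs_on z).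
have hG z : [/\ connected_graph (G z), locally_finite (G z)
              & has_number_of_ends (G z) 1].
  by split; [exact: connected_ray|exact: locally_finite_ray|exact: ends_ray].
have runs_S k (f g : k.-tuple nat -> nat) : recursive f -> recursive g ->
    recursive (fun x => (runs_on (f x) (g x)).+1).
  move=> rf rg; apply: recursive_succ.
  exact: (recursive_comp2 computable2_runs_on rf rg).
have uhc : uniformly_highly_computable G.
  split.
  - apply: eq_recursive (recursive_const 2 1) => x.
    by have -> : nth 0 x 1 \in vertices (G (nth 0 x 0)) by apply/mem_set.
  - pose f z u v := if v == u.+1 then (runs_on z u).+1
      else if u == v.+1 then (runs_on z v).+1 else 0.
    apply: (@eq_recursive _ (fun x => f (nth 0 x 0) (nth 0 x 1) (nth 0 x 2))).
      by move=> x; rewrite nb_edges_ray.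
    apply: recursive_if; first by prove_recursive.
      by apply: runs_S; exact: recursive_nth.
    apply: recursive_if; first by prove_recursive.
      by apply: runs_S; exact: recursive_nth.
    exact: recursive_const.
  - by move=> z; have [] := hG z.
  (* The match on [v] becomes a test and a predecessor, both recursive; the predecessor is used only
     for nonzero [v]. *)
  - pose f z v := (runs_on z v).+1 + if v == 0 then 0 else (runs_on z v.-1).+1.
    apply: (@eq_recursive _ (fun x => f (nth 0 x 0) (nth 0 x 1))).
      by move=> x; rewrite degree_ray /f; case: (nth 0 x 1).
    apply: recursive_add; first by apply: runs_S; exact: recursive_nth.
    apply: recursive_if; [by prove_recursive|exact: recursive_const|].
    by apply: runs_S; [exact: recursive_nth|exact/recursive_pred/recursive_nth].
exists G; split=> //; split; first exact: PiE.
move=> B /runs_on_Pi01_hard[f [rf BE]]; exists f; split=> // x.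
rewrite BE /=; have [conn lf ends] := hG (f x).
by rewrite (two_way_eulerianP lf conn ends) even_degree_ray.
Qed.
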